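(* An arbitrary nonempty max-plus convex subset $C$ of $E$ has the fixed point property for upper semicontinuous compact maps with closed max-plus convex nonempty values: if $\Gamma:C\to C$ is an upper semicontinuous compact multivalued map with nonempty closed max-plus convex values, then there exists $x\in C$ such that $x\in\Gamma x$.
   Context: $E\neq\{0\}$ is an Archimedean Riesz space (real vector lattice; Archimedean means that if $ny\leqslant x$ for all $n\in\mathbb{N}$ then $y\leqslant 0$), and $\mathbf{u}\in E_+$ is a unit: for every $x\in E_+$ there is $n\in\mathbb{N}$ with $x\leqslant n\mathbf{u}$. The topology on $E$ is that of the metric $\mathsf{D}_{\mathbf{hu}}(x,y)=\max\{0,\mathbf{p}_{\mathbf{u}}(x-y)\}+\max\{0,\mathbf{p}_{\mathbf{u}}(y-x)\}$, where $\mathbf{p}_{\mathbf{u}}(x)=\inf\{t\in\mathbb{R}:x\leqslant t\mathbf{u}\}$. The max-plus convex hull of a nonempty $S\subset E$ is the set $[\![S]\!]$ of all elements $(x_1+t_1\mathbf{u})\vee\cdots\vee(x_m+t_m\mathbf{u})$ with $m\ge1$, $x_i\in S$, $t_i\in\mathbb{R}$ and $\max_i t_i=0$; $[\![\emptyset]\!]=\emptyset$. A set $C\subset E$ is max-plus convex if $C=[\![C]\!]$. A multivalued map $\Gamma:X\to Y$ assigns to each $x\in X$ a subset $\Gamma x\subset Y$; it is upper semicontinuous if $\{x\in X:\Gamma x\subset V\}$ is open for every open $V\subset Y$, and it is compact if there is a compact set $K\subset Y$ with $\Gamma x\subset K$ for all $x\in X$. *)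

(* Defs.v *)
From HB Require Import structures.
From mathcomp Require Import all_boot all_order all_algebra.
From mathcomp Require Import all_classical all_reals all_analysis.

Set Implicit Arguments.
Unset Strict Implicit.
Unset Printing Implicit Defensive.

Import Order.TTheory GRing.Theory Num.Theory.

Local Open Scope classical_set_scope.
Local Open Scope ring_scope.

(* The lattice operations are fields, because the hierarchy has no joins between
   the lattice and the module structures below realDomainType. *)
HB.mixin Record POrderedLmodule_isRiesz (R : realType) E
    of Order.POrder ring_display E & GRing.Lmodule R E := {
  riesz_leD2r : forall z x y : E, x <= y -> x + z <= y + z ;
  riesz_scale_ge0 : forall (a : R) (x : E), 0 <= a -> 0 <= x -> 0 <= a *: x ;
  riesz_join : E -> E -> E ;
  riesz_meet : E -> E -> E ;
  riesz_geU : forall x y z : E, (riesz_join x y <= z) = (x <= z) && (y <= z) ;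
  riesz_leI : forall x y z : E, (z <= riesz_meet x y) = (z <= x) && (z <= y)
}.

#[short(type="rieszType")]
HB.structure Definition Riesz (R : realType) :=
  { E of Order.POrder ring_display E & GRing.Lmodule R E
       & POrderedLmodule_isRiesz R E }.

Section Definitions.
Context {R : realType} {E : rieszType R}.
Implicit Types (u x y : E) (S C : set E).

Definition riesz_unit u : Prop :=
  0 <= u /\ forall x, 0 <= x -> exists n : nat, x <= n%:R *: u.

(* When u is a unit and E is nonzero, the set is nonempty and bounded below, so
   that inf is the genuine infimum. *)
Definition pu u x : R := inf [set t : R | x <= t *: u].

Definition Dhu u x y : R :=
  Num.max 0 (pu u (x - y)) + Num.max 0 (pu u (y - x)).

(* Families are indexed by 'I_m.+1, hence nonempty.  Since E has no bottom
   element and R no least element, both iterated operations start from the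
   term of index 0, which is harmless as they are idempotent. *)
Definition mphull u S : set E :=
  [set z | exists (m : nat) (x : 'I_m.+1 -> E) (t : 'I_m.+1 -> R),
    [/\ forall i, S (x i),
        \big[Num.max/t ord0]_(i < m.+1) t i = 0
      & z = \big[riesz_join/x ord0 + t ord0 *: u]_(i < m.+1)
              (x i + t i *: u)]].

Definition mpconvex u C : Prop := C = mphull u C.

End Definitions.

Definition riesz_archimedean (R : realType) (E : rieszType R) : Prop :=
  forall x y : E, (forall n : nat, n%:R *: y <= x) -> y <= 0.

Section MetricLemmas.
Context {R : realType} {E : rieszType R} (u : E).
Context (E_neq0 : exists x : E, x != 0) (E_arch : riesz_archimedean E).
Context (u_unit : riesz_unit u).
Implicit Types (x y z : E) (s t : R).

Let leD x y z w : x <= y -> z <= w -> x + z <= y + w.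
Proof.
move=> xy zw; apply: le_trans (riesz_leD2r z _ _ xy) _.
by rewrite ![y + _]addrC; apply: riesz_leD2r.
Qed.

Let sub_ge0 x y : (0 <= y - x) = (x <= y).
Proof.
apply/idP/idP => h.
  by have := riesz_leD2r x _ _ h; rewrite add0r subrK.
by have := riesz_leD2r (- x) _ _ h; rewrite subrr.
Qed.

Let u_ge0 : 0 <= u. Proof. by case: u_unit. Qed.

Let scale_le s t : s <= t -> s *: u <= t *: u.
Proof.
move=> st; rewrite -sub_ge0 -scalerBl.
by apply: riesz_scale_ge0; rewrite ?subr_ge0.
Qed.

Let le_unit x : exists n : nat, x <= n%:R *: u.
Proof.
have := lexx (riesz_join x 0); rewrite riesz_geU => /andP[xj j0].
by have [n jn] := u_unit.2 _ j0; exists n; exact: le_trans jn.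
Qed.

Let u_neq0 : u != 0.
Proof.
apply/eqP => u0; case: E_neq0 => x /eqP; apply; apply/le_anti/andP; split.
  by have [n] := le_unit x; rewrite u0 scaler0.
by have [n] := le_unit (- x); rewrite u0 scaler0 -sub_ge0 sub0r opprK.
Qed.

Let scale_ge0P t : 0 <= t *: u -> 0 <= t.
Proof.
move=> tu; rewrite leNgt; apply/negP => t0; move/negP: u_neq0; apply.
rewrite eq_le u_ge0 andbT -sub_ge0 sub0r.
have := riesz_scale_ge0 (- t^-1) _ _ tu.
rewrite scalerA mulNr mulVf ?lt_eqF// scaleN1r; apply.
by rewrite oppr_ge0 invr_le0 ltW.
Qed.

Let pu_has_inf x : has_inf [set t : R | x <= t *: u].
Proof.
split; first by have [n xn] := le_unit x; exists n%:R.
have [n xn] := le_unit (- x); exists (- n%:R) => t /= xt.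
rewrite -subr_ge0 opprK; apply: scale_ge0P.
by rewrite scalerDl -(subrr x); apply: leD.
Qed.

Let pu_le x t : x <= t *: u -> pu u x <= t.
Proof. by move=> xt; apply: ge_inf => //; have [] := pu_has_inf x. Qed.

Let pu_lt x t : pu u x < t -> x <= t *: u.
Proof.
move=> /(inf_lt (pu_has_inf x).1)[s /= xs st].
by apply: le_trans xs _; apply: scale_le; exact: ltW.
Qed.

Let pu_le0 x : pu u x <= 0 -> x <= 0.
Proof.
move=> px; apply: (E_arch (x := u)) => -[|n]; first by rewrite scale0r.
have xn : x <= n.+1%:R^-1 *: u by apply: pu_lt; rewrite (le_lt_trans px).
rewrite -sub_ge0; suff -> : u - n.+1%:R *: x = n.+1%:R *: (n.+1%:R^-1 *: u - x).
  by apply: riesz_scale_ge0; rewrite ?sub_ge0.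
by rewrite scalerBr scalerA divff ?scale1r// pnatr_eq0.
Qed.

Let pu0 : pu u 0 = 0.
Proof.
apply/le_anti/andP; split; first by apply: pu_le; rewrite scale0r.
apply: lb_le_inf; first by exists 0 => /=; rewrite scale0r.
by move=> t /=; exact: scale_ge0P.
Qed.

Let puD x y : pu u (x + y) <= pu u x + pu u y.
Proof.
apply/ler_addgt0Pl => e e0; apply: pu_le.
have -> : e + (pu u x + pu u y) = (pu u x + e / 2) + (pu u y + e / 2).
  by rewrite addrACA -splitr addrC.
by rewrite scalerDl; apply: leD; apply: pu_lt; rewrite ltrDl divr_gt0.
Qed.

Lemma Dhuxx x : Dhu u x x = 0.
Proof. by rewrite /Dhu subrr pu0 maxxx addr0. Qed.

Lemma Dhu_sym x y : Dhu u x y = Dhu u y x.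
Proof. by rewrite /Dhu addrC. Qed.

Let max_ge0 t : 0 <= Num.max 0 t. Proof. by rewrite le_max lexx. Qed.

Lemma Dhu_positivity x y : Dhu u x y = 0 -> x = y.
Proof.
move/eqP; rewrite paddr_eq0 // => /andP[/eqP h1 /eqP h2].
have p1 : pu u (x - y) <= 0 by rewrite -h1 le_max lexx orbT.
have p2 : pu u (y - x) <= 0 by rewrite -h2 le_max lexx orbT.
apply/le_anti/andP; split; rewrite -sub_ge0.
  by move/pu_le0: p1; rewrite -sub_ge0 sub0r opprB.
by move/pu_le0: p2; rewrite -sub_ge0 sub0r opprB.
Qed.

Lemma Dhu_triangle y x z : Dhu u x z <= Dhu u x y + Dhu u y z.
Proof.
have tri a b c : Num.max 0 (pu u (a - c)) <=
    Num.max 0 (pu u (a - b)) + Num.max 0 (pu u (b - c)).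
  rewrite ge_max addr_ge0 //=.
  have -> : a - c = (a - b) + (b - c) by rewrite addrA subrK.
  by apply: le_trans (puD _ _) _; apply: lerD; rewrite le_max lexx orbT.
rewrite /Dhu addrACA; apply: lerD; first exact: tri.
by rewrite [leRHS]addrC; exact: tri.
Qed.

End MetricLemmas.

(* E as the metric space with distance Dhu u; the three proofs are those under
   which Dhu u is a metric.  *)
Definition hu_space (R : realType) (E : rieszType R) (u : E)
    (E_neq0 : exists x : E, x != 0) (E_arch : riesz_archimedean E)
    (u_unit : riesz_unit u) : Type := E.

Section HuSpace.
Context {R : realType} {E : rieszType R} {u : E}.
Context (E_neq0 : exists x : E, x != 0) (E_arch : riesz_archimedean E).
Context (u_unit : riesz_unit u).

HB.instance Definition _ := Choice.copy (hu_space E_neq0 E_arch u_unit) E.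
HB.instance Definition _ :=
  @isMetric.Build R (hu_space E_neq0 E_arch u_unit) (Dhu u)
    (Dhuxx E_neq0 u_unit)
    (Dhu_positivity E_neq0 E_arch u_unit)
    (Dhu_sym u)
    (Dhu_triangle E_neq0 u_unit).

End HuSpace.

Section Multimaps.
Context {X Y : topologicalType}.
Implicit Types G : X -> set Y.

Definition mv_usc G : Prop :=
  forall V : set Y, open V -> open [set x | G x `<=` V].

Definition mv_compact G : Prop :=
  exists2 K : set Y, compact K & forall x, G x `<=` K.

End Multimaps.

(* Main.v *)
Require Import Defs.
From HB Require Import structures.
From mathcomp Require Import all_boot all_order all_algebra.
From mathcomp Require Import all_classical all_reals all_analysis.
From mathcomp Require Import zify ring lra.

Set Implicit Arguments.
Unset Strict Implicit.
Unset Printing Implicit Defensive.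

Import Order.TTheory GRing.Theory Num.Theory.
Import numFieldNormedType.Exports.

(** The theorem is a max-plus Kakutani theorem, and the proof is the classical
    one with suprema in place of convex combinations.

    Fix e > 0 and cover the compact range of G by finitely many e-balls with
    centres y_0, ..., y_m in C.  The map
      psi p = \/_i (y_i + L (p_i - max_k p_k) u)
    sends the standard simplex to C, because its largest coefficient is 0, and
    it is Lipschitz.  If L is large, then a small coordinate p_i gives y_i so
    negative a coefficient that this term does not contribute to psi p, so psi
    maps the faces of the simplex to the max-plus hulls of the corresponding
    centres.  Colour p by an index i for which y_i is e-close to some point of
    G (psi p).  A KKM-type lemma (kkm_coloring) gives a point p and a set J of
    colours which all occur arbitrarily near p, and p_i is nearly 0 for i
    outside J.  By upper semicontinuity every y_j with j in J is close to a
    point g_j of G (psi p), while psi p is the supremum of the y_j + t_j u over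
    j in J.  Translations and suprema do not increase distances, so psi p is
    close to the corresponding max-plus combination of the g_j, which belongs
    to G (psi p) (approximate_fixpoint).  As e tends to 0, the image points
    cluster at some z in the compact range, and upper semicontinuity at z puts
    z in the closure of G z (usc_compact_fixpoint).

    The KKM lemma, which carries the content of the theorem of Brouwer, is
    obtained without triangulations from a purely order-theoretic form of
    Scarf's lemma (scarf), proved by a parity argument.  A finite set V is
    given one total order for each of the n colours; the n-element sets T such
    that no point of V exceeds the minimum of T in every order behave like the
    top cells of a triangulation of a simplex, because a set of n - 1 points is
    contained in none, one or two of them, one only on the boundary
    (completions_even, completions_corner).  Applied to the points of a fine
    grid of the simplex, ordered by their coordinates, it yields a small set of
    grid points with the required colours (grid_cluster). *)

(** * Scarf's lemma for finitely many total orders *)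

(** No y exceeds the minima of T in all the orders given by the ranks r i at
    once.  Stating this with an element of T below y avoids naming the minima,
    which do not exist when T is empty. *)
Definition dominant (I V : finType) (r : I -> V -> nat) (T : {set V}) : bool :=
  [forall y, ~~ [forall i, [exists a in T, r i a < r i y]]].

Section Scarf.
(* Several names of finite sets are also names of classical sets. *)
Import mathcomp.boot.finset.

Context (I V : finType) (r : I -> V -> nat).
Context (r_inj : forall i, injective (r i)).

Lemma dominantP (T : {set V}) :
  reflect (forall y, ~ forall i, exists2 a, a \in T & r i a < r i y)
    (dominant r T).
Proof.
apply: (iffP forallP) => h y.
  by move=> hy; move: (h y) => /forallP; apply=> i; apply/exists_inP/hy.
by apply/forallP => hy; apply: (h y) => i; apply/exists_inP/hy.
Qed.

(** A dominant set with as many points as there are orders is indexed by the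
    orders: a point which is minimal in no order would be above all minima, so
    that i |-> min_i T maps onto T, and is injective by counting. *)
Lemma minima_of_dominant (T : {set V}) :
  #|T| = #|I| -> dominant r T ->
  exists f : I -> V, [/\ injective f, T = f @: [set: I]
    & forall i k, r i (f i) <= r i (f k)].
Proof.
move=> cT /dominantP dT.
have minT i : exists a, (a \in T) && [forall b in T, r i a <= r i b].
  have /card_gt0P[a0 a0T] : 0 < #|T| by rewrite cT; apply/card_gt0P; exists i.
  case: (arg_minnP (r i) a0T) => a aT amin; exists a; rewrite [_ \in _]aT.
  by apply/forall_inP.
pose f i := xchoose (minT i).
have fT i : f i \in T by have /andP[] := xchooseP (minT i).
have fmin i b : b \in T -> r i (f i) <= r i b.
  by have /andP[_ /forall_inP] := xchooseP (minT i); apply.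
have Tf : T = f @: [set: I].
  apply/setP=> a; apply/idP/imsetP => [aT|[i _ ->] //].
  have [/existsP[i /eqP fia]|/existsPn na] := boolP [exists i, f i == a].
    by exists i.
  case: (dT a) => i; exists (f i) => //; rewrite ltn_neqAle fmin // andbT.
  by apply: contra (na i) => /eqP/r_inj->.
exists f; split=> // [|i k]; last exact/fmin/fT.
suff /imset_injP fi : #|f @: [set: I]| == #|[set: I]|.
  by move=> i k; apply: fi; rewrite inE.
by rewrite -Tf cT cardsT.
Qed.

(** The slack point s i is the least point of order i and is above all ordinary
    points in the other orders.  Slack points play the role of the vertices of
    a large simplex around the ordinary points: the boundary then consists of
    sets of slack points only. *)
Context (s : I -> V).
Context (s_low : forall i v, v != s i -> r i (s i) < r i v).
Context (s_high : forall i k v, i != k -> (forall l, v != s l) ->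
  r i v < r i (s k)).

Definition completions (S : {set V}) :=
  [set v | (v \notin S) && dominant r (v |: S)].

(** The pivot step.  If v completes S, let j be the order in which v is minimal
    in v |: S, and let i be the order whose minimum becomes the minimum of S in
    order j once v is removed.  Another completion must take over the role of
    minimum in order j or i.  In order j it can only be v itself; in order i it
    is the point w which is largest in order i among those above the minima of S
    in all other orders.  Such points exist as soon as S contains an ordinary
    point, since the slack point s i is one of them.  So there are exactly two
    completions, or none. *)
Lemma completions_even (S : {set V}) (a : V) :
  #|S|.+1 = #|I| -> a \in S -> (forall l, a != s l) ->
  ~~ odd #|completions S|.
Proof.
move=> cS aS a_real.
have [->|/set0Pn[v]] := eqVneq (completions S) set0; first by rewrite cards0.
rewrite inE => /andP[vS vdom].
have cT y : y \notin S -> #|y |: S| = #|I| by move=> yS; rewrite cardsU1 yS.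
have [f [f_inj fT f_min]] := minima_of_dominant (cT v vS) vdom.
have [j _ vE] : exists2 j, j \in [set: I] & v = f j.
  by apply/imsetP; rewrite -fT setU11.
have fS k : k != j -> f k \in S.
  move=> kj; have : f k \in v |: S by rewrite fT imset_f.
  rewrite !inE => /orP[/eqP|//].
  by rewrite vE => /f_inj/eqP; rewrite (negPf kj).
have Sf b : b \in S -> exists2 k, k != j & b = f k.
  move=> bS; have : b \in v |: S by rewrite inE bS orbT.
  rewrite fT => /imsetP[k _ bE]; exists k => //.
  by apply: contraNneq vS => kj; rewrite vE -kj -bE.
have [i ij i_next] :
    exists2 i, i != j & forall b, b \in S -> r j (f i) <= r j b.
  case: (arg_minnP (r j) aS) => b /Sf[i ij ->] imin; by exists i.
have fS_min k b : k != j -> b \in S -> r k (f k) <= r k b.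
  by move=> kj /Sf[l _ ->].
(* The candidates for the minimum in order i; note that f i is the minimum of S
   in order j. *)
pose above y := [forall k, if k == j then r j (f i) < r j y
                           else (k != i) ==> (r k (f k) < r k y)].
have aboveP y : reflect (r j (f i) < r j y /\
    forall k, k != i -> k != j -> r k (f k) < r k y) (above y).
  apply: (iffP forallP) => [h|[h1 h2] k].
    split=> [|k ki kj]; first by have := h j; rewrite eqxx.
    by have := h k; rewrite (negPf kj) ki.
  by have [_|kj] := eqVneq k j => //; apply/implyP => ki; apply: h2.
have si_above : above (s i).
  apply/aboveP; split=> [|k ki kj].
    by apply: leq_ltn_trans (i_next a aS) _; apply: s_high; rewrite // eq_sym.
  by apply: leq_ltn_trans (fS_min k a kj aS) _; apply: s_high.
case: (arg_maxnP (r i) si_above) => w /aboveP[wj wk] w_max.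
have wS : w \notin S.
  apply/negP => /Sf[k kj wE]; have [ki|ki] := eqVneq k i.
    by move: wj; rewrite wE ki ltnn.
  by have := wk k ki kj; rewrite wE ltnn.
have wv : w != v.
  by apply: contraTneq wj => ->; rewrite vE -leqNgt.
have wdom : dominant r (w |: S).
  apply/dominantP => y hy.
  have yb l b : (forall c, c \in w |: S -> r l b <= r l c) -> r l b < r l y.
    by move=> hb; have [c cwS cy] := hy l; apply: leq_ltn_trans cy; apply: hb.
  have ya : above y.
    apply/aboveP; split=> [|k ki kj]; apply: yb => c; rewrite !inE.
      by case/predU1P=> [->|]; [exact: ltnW | exact: i_next].
    by case/predU1P=> [->|]; [exact/ltnW/wk | exact: fS_min].
  have yw : r i y <= r i w by exact: w_max.
  have iy : r i (f i) < r i y.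
    have [c] := hy i; rewrite !inE => /predU1P[->|]; first by rewrite ltnNge yw.
    by move=> cw; apply: leq_ltn_trans; apply: fS_min.
  have [yj yk] := aboveP _ ya.
  move/dominantP: vdom => /(_ y); apply=> l.
  have [->|lj] := eqVneq l j.
    by exists (f j); rewrite ?vE ?setU11 //; apply: leq_ltn_trans yj.
  exists (f l); first by rewrite inE fS ?orbT.
  by have [->|li] := eqVneq l i => //; apply: yk.
(* Conversely a completion z is minimal in its set in some order j', and j' is
   j or i, because otherwise f i would be the minimum in both orders. *)
suff -> : completions S = [set v; w] by rewrite cards2 eq_sym wv.
apply/setP => z; rewrite !inE; apply/andP/orP; last first.
  by case=> /eqP->.
move=> [zS zdom].
have [g [g_inj gT g_min]] := minima_of_dominant (cT z zS) zdom.
have [j' _ zE] : exists2 j', j' \in [set: I] & z = g j'.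
  by apply/imsetP; rewrite -gT setU11.
have gS k : k != j' -> g k \in S.
  move=> kj; have : g k \in z |: S by rewrite gT imset_f.
  rewrite !inE => /orP[/eqP|//].
  by rewrite zE => /g_inj/eqP; rewrite (negPf kj).
have g_min' k b : b \in z |: S -> r k (g k) <= r k b.
  by rewrite gT => /imsetP[l _ ->].
have gf k : k != j -> k != j' -> g k = f k.
  move=> kj kj'; apply: (@r_inj k); apply/eqP; rewrite eqn_leq.
  by rewrite fS_min ?gS // g_min' // inE fS ?orbT.
have zk k : k != j -> k != j' -> r k (f k) < r k z.
  move=> kj kj'; rewrite ltn_neqAle -(gf k kj kj') {2}zE g_min andbT.
  apply: contraNneq zS => /r_inj <-; exact: gS.
have gj : j != j' -> g j = f i.
  move=> jj'; apply: (@r_inj j); apply/eqP; rewrite eqn_leq.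
  by rewrite i_next ?gS // g_min' // inE fS ?orbT.
have [jj'|jj'] := eqVneq j j'.
  left; apply/eqP/(@r_inj j)/eqP; rewrite eqn_leq; apply/andP; split.
    rewrite leqNgt; apply/negP => zv.
    move/dominantP: vdom => /(_ z); apply=> l.
    have [->|lj] := eqVneq l j; first by exists v; rewrite ?setU11.
    by exists (f l); rewrite ?inE ?fS ?orbT // zk // -jj'.
  rewrite leqNgt; apply/negP => vz.
  move/dominantP: zdom => /(_ v); apply=> l.
  have [->|lj] := eqVneq l j; first by exists z; rewrite ?setU11.
  exists (f l); first by rewrite inE fS ?orbT.
  rewrite ltn_neqAle vE f_min andbT; apply: contraNneq lj => /r_inj /f_inj ->.
  by [].
have [ij'|ij'] := eqVneq i j'; last first.
  have : g i = g j by rewrite gj // gf.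
  by move/g_inj/eqP; rewrite (negPf ij).
right; apply/eqP/(@r_inj i)/eqP; rewrite eqn_leq; apply/andP; split.
  apply: w_max; apply/aboveP; split=> [|k ki kj]; last by rewrite zk // -ij'.
  rewrite -(gj jj') ltn_neqAle {2}zE g_min andbT.
  apply: contraNneq zS => /r_inj <-; exact: gS.
rewrite leqNgt; apply/negP => zw.
move/dominantP: zdom => /(_ w); apply=> l.
have [->|li] := eqVneq l i; first by exists z; rewrite ?setU11.
have [->|lj] := eqVneq l j; first by exists (f i); rewrite ?inE ?fS ?orbT.
by exists (f l); rewrite ?inE ?fS ?orbT ?wk.
Qed.

Context (v0 : V) (v0_real : forall l, v0 != s l).

(** A boundary set has a single completion, the ordinary point which is largest
    in the remaining order. *)
Lemma completions_corner (i : I) :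
  odd #|completions (s @: [set~ i])|.
Proof.
pose real v := [forall l, v != s l].
have v0r : real v0 by apply/forallP.
case: (arg_maxnP (r i) v0r) => w /forallP w_real w_max.
suff -> : completions (s @: [set~ i]) = [set w] by rewrite cards1.
have not_slack v : (forall l, v != s l) -> v \notin s @: [set~ i].
  by move=> vr; apply/imsetP => -[l _ vE]; have := vr l; rewrite vE eqxx.
have slackP v : v \in s @: [set~ i] -> exists2 k, k != i & v = s k.
  by case/imsetP=> k; rewrite !inE; exists k.
have slack_in k : k != i -> s k \in s @: [set~ i].
  by move=> ki; rewrite imset_f // !inE.
have domP z : (dominant r (z |: s @: [set~ i])) =
    [forall y, real y ==> (r i y <= r i z)].
  apply/dominantP/forall_inP => [zdom y /forallP yr | h y hy].
    rewrite leqNgt; apply/negP => zy; case: (zdom y) => k.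
    have [->|ki] := eqVneq k i; first by exists z; rewrite ?setU11.
    by exists (s k); [rewrite inE slack_in ?orbT | apply: s_low].
  have [/existsP[k /eqP yk]|/existsPn yr] := boolP [exists k, y == s k].
    have [c _] := hy k; have [->|ck] := eqVneq c (s k).
      by rewrite yk ltnn.
    by rewrite yk ltnNge ltnW // s_low.
  have [c] := hy i; rewrite !inE => /orP[/eqP->|/slackP[k ki ->]].
    by rewrite ltnNge h //; apply/forallP.
  by rewrite ltnNge ltnW // s_high // eq_sym.
apply/setP => z; rewrite !inE domP.
apply/andP/eqP => [[zS /forall_inP zmax]|->].
  have [/existsP[k /eqP zk]|/existsPn zr] := boolP [exists k, z == s k].
    have ki : k = i by apply/eqP; apply: contraNT zS => ki; rewrite zk slack_in.
    by have := zmax v0 v0r; rewrite leqNgt zk ki s_low.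
  apply: (@r_inj i); apply/eqP; rewrite eqn_leq zmax ?andbT; last exact/forallP.
  by apply: w_max; apply/forallP.
by split; [exact: not_slack | apply/forall_inP => y; exact: w_max].
Qed.

Context (c : V -> I) (cs : forall i, c (s i) = i).

(** If T misses a colour and T :\ v has exactly the colours other than i0, then
    these colours occur once each in T :\ v by counting, v repeats one of them,
    and v and the other point with its colour are the only points of T whose
    removal leaves these colours. *)
Lemma almost_rainbow_parity (i0 : I) (T : {set V}) :
  #|T| = #|I| -> c @: T != [set: I] ->
  ~~ odd #|[set v in T | c @: (T :\ v) == [set~ i0]]|.
Proof.
move=> cT cTI.
have [->|/set0Pn[v]] := eqVneq [set v in T | c @: (T :\ v) == [set~ i0]] set0.
  by rewrite cards0.
rewrite inE => /andP[vT /eqP cv].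
have c_inj : {in T :\ v &, injective c}.
  apply/imset_injP; rewrite cv cardsCs setCK cards1 -cT.
  by rewrite (cardsD1 v T) vT addKn.
have cvi0 : c v != i0.
  apply: contraNneq cTI => cvi; apply/eqP/setP => i; rewrite !inE.
  have [->|ii0] := eqVneq i i0; first by rewrite -cvi imset_f.
  have : i \in c @: (T :\ v) by rewrite cv !inE.
  by apply/fintype.subsetP/imsetS/subsetDl.
have [v' v'T cE] : exists2 v', v' \in T :\ v & c v = c v'.
  by apply/imsetP; rewrite cv !inE.
move: (v'T); rewrite !inE => /andP[v'v v'T'].
suff -> : [set v in T | c @: (T :\ v) == [set~ i0]] = [set v; v'].
  by rewrite cards2 eq_sym v'v.
apply/setP => z; rewrite !inE; apply/andP/orP => [[zT /eqP cz]|].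
  have [->|zv] := eqVneq z v; [by left | right].
  have cz0 : c z \in [set~ i0] by rewrite -cv imset_f // !inE zv.
  move: cz0; rewrite -cz => /imsetP[t]; rewrite !inE => /andP[tz tT] czt.
  have [tv|tv] := eqVneq t v.
    by apply/eqP/c_inj; rewrite ?czt ?tv ?inE ?zv ?v'v.
  have zt : z = t by apply: c_inj; rewrite ?inE ?zv ?tv.
  by rewrite zt eqxx in tz.
case=> /eqP ->; split=> //; first by rewrite cv.
rewrite -cv; apply/eqP/setP => i.
apply/imsetP/imsetP => -[t]; rewrite !inE => /andP[t1 tT] ->.
  have [->|tv] := eqVneq t v; first by exists v'; rewrite ?inE ?v'v.
  by exists t; rewrite ?inE ?tv.
have [->|tv] := eqVneq t v'; first by exists v; rewrite ?inE // eq_sym v'v.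
by exists t; rewrite ?inE ?tv.
Qed.

(** Count in two ways the pairs (S, v) where S has exactly the colours other
    than i0, each once, and v completes S.  Grouped by S, the number is odd,
    since the slack points other than s i0 form the only such S without
    ordinary point.  Grouped by T = v |: S, only the sets T with all colours
    can contribute an odd number. *)
Lemma scarf (i0 : I) :
  exists T : {set V}, [/\ #|T| = #|I|, dominant r T & c @: T = [set: I]].
Proof.
pose door (S : {set V}) := (c @: S == [set~ i0]) && (#|S|.+1 == #|I|).
pose room (T : {set V}) := (#|T| == #|I|) && dominant r T.
have s_inj : injective s by apply: can_inj cs.
have I_gt0 : 0 < #|I| by apply/card_gt0P; exists i0.
have count : \sum_(S | door S) #|completions S| =
    \sum_(T | room T) #|[set v in T | c @: (T :\ v) == [set~ i0]]|.
  under eq_bigr do rewrite -sum1_card.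
  under [RHS]eq_bigr do rewrite -sum1_card.
  rewrite (exchange_big_dep predT) //= [RHS](exchange_big_dep predT) //=.
  apply: eq_bigr => v _; rewrite !sum1_card.
  pose P := [pred S | door S & v \in completions S].
  rewrite -[LHS]/#|P| -(card_in_imset (f := fun S => v |: S) (D := P)).
    apply: eq_card => T; rewrite [RHS]unfold_in inE -andbA.
    apply/imsetP/and4P => [[S]|[/eqP cT dT vT /eqP cv]].
      rewrite !inE => /andP[/andP[dS /eqP cS] /andP[vS dom]] ->.
      by rewrite cardsU1 vS add1n cS eqxx dom setU1K // setU11.
    exists (T :\ v); last by rewrite setD1K.
    rewrite !inE /door cv setD1K // dT !eqxx /= !andbT.
    by rewrite -cT (cardsD1 v T) vT add1n.
  move=> S1 S2; rewrite !inE /= => /andP[_ /andP[v1 _]] /andP[_ /andP[v2 _]] E.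
  by rewrite -(setU1K v1) E setU1K.
pose S0 := s @: [set~ i0].
have S0door : door S0.
  rewrite /door /S0 -imset_comp card_imset // cardsCs setCK cards1.
  rewrite subn1 prednK // eqxx andbT; apply/eqP.
  by rewrite -[RHS]imset_id; apply: eq_imset => i /=; rewrite cs.
have odd_doors : odd (\sum_(S | door S) #|completions S|).
  rewrite (bigD1 S0) //= oddD completions_corner /=.
  rewrite -dvdn2; apply: dvdn_sum => S /andP[/andP[/eqP dS /eqP cS] SS0].
  rewrite dvdn2.
  have [/exists_inP[a aS /forallP ar]|/exists_inPn noreal] :=
    boolP [exists a in S, [forall l, a != s l]].
    exact: completions_even ar.
  case/eqP: SS0; rewrite /S0 -dS -imset_comp -[LHS]imset_id.
  apply: eq_in_imset => a /noreal /forallPn[l /negPn/eqP -> /=].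
  by rewrite cs.
have [/exists_inP[T /andP[/eqP cT dT] /eqP cTI]|/exists_inPn none] :=
  boolP [exists T in room, c @: T == [set: I]]; first by exists T.
move: odd_doors; rewrite count -[odd _]negbK -dvdn2 dvdn_sum // => T rT.
by rewrite dvdn2 almost_rainbow_parity ?none //; case/andP: rT => /eqP.
Qed.

End Scarf.

(** * Clusters of grid points of a simplex *)

Section Grid.
Import mathcomp.boot.finset.

Context (I : finType) (N : nat).

(** The points of the standard simplex with denominator N, scaled by N. *)
Record gridpoint := GridPoint {
  coord :> {ffun I -> 'I_N.+1}; _ : \sum_i coord i == N }.
HB.instance Definition _ := [isSub for coord].
HB.instance Definition _ := [Finite of gridpoint by <:].

(** The enumeration of the grid only breaks ties between equal coordinates;
    inr k is the slack point of the colour k. *)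
Definition grid_rank (i : I) (v : gridpoint + I) : nat :=
  match v with
  | inl x => (x i * #|{: gridpoint}| + enum_rank x).+1
  | inr k => if k == i then 0 else (N.+1 * #|{: gridpoint}| + enum_rank k).+1
  end.

Lemma sum_coord (x : gridpoint) : \sum_i coord x i = N.
Proof. by case: x => x /= /eqP. Qed.

Lemma grid_rank_slack_gt (i k : I) (x : gridpoint) :
  i != k -> grid_rank i (inl x) < grid_rank i (inr k).
Proof.
move=> ik /=; rewrite eq_sym (negPf ik) ltnS.
apply: (@leq_trans ((x i).+1 * #|{: gridpoint}|)).
  by rewrite mulSn addnC ltn_add2r.
by apply: (leq_trans _ (leq_addr _ _)); rewrite leq_mul2r ltn_ord orbT.
Qed.

Lemma grid_rank_inj (i : I) : injective (grid_rank i).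
Proof.
move=> [x|k] [y|l] //=.
- move=> [E]; congr inl; apply: enum_rank_inj; apply: val_inj => /=.
  have := congr1 (modn^~ #|{: gridpoint}|) E.
  by rewrite /= !modnMDl !modn_small.
- have [//|li /eqP] := eqVneq l i.
  have := @grid_rank_slack_gt i l x; rewrite eq_sym /= (negPf li) => /(_ isT).
  by move/ltn_eqF=> ->.
- have [//|li /eqP] := eqVneq k i.
  have := @grid_rank_slack_gt i k y; rewrite eq_sym /= (negPf li) => /(_ isT).
  by move/ltn_eqF; rewrite eq_sym => ->.
- have [->|ki] := eqVneq k i; have [->|li] := eqVneq l i => //.
  by case=> /addnI /val_inj /enum_rank_inj ->.
Qed.

Lemma grid_rank_le (i : I) (x y : gridpoint) :
  grid_rank i (inl x) <= grid_rank i (inl y) -> x i <= y i.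
Proof.
rewrite /= ltnS => /(leq_div2r #|{: gridpoint}|).
have X0 : 0 < #|{: gridpoint}| by apply/card_gt0P; exists x.
by rewrite !divnMDl // !divn_small // !addn0.
Qed.

(** Let A be the ordinary points of the set given by Scarf's lemma, and J the
    colours whose slack point is not in it.  Dominance says that no grid point
    exceeds the minima low i of A in all coordinates i of J.  Hence the sum of
    low i + 1 over J is larger than N: otherwise these numbers, with the excess
    added to one of them, would be the coordinates of such a grid point.  A
    point of A has coordinate sum N and coordinates at least low i on J, so
    less than #|I| is left to distribute. *)
Lemma grid_cluster (i0 : I) (c : gridpoint -> I) :
  exists (A : {set gridpoint}) (J : {set I}), [/\ A != set0,
    forall j, j \in J -> exists2 a, a \in A & c a = j,
    forall a i, a \in A -> i \notin J -> a i <= #|I|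
    & forall a b i, a \in A -> b \in A -> a i <= b i + #|I|].
Proof.
pose c' (v : gridpoint + I) := match v with inl x => c x | inr k => k end.
have x0P :
    \sum_i [ffun i => if i == i0 then ord_max else ord0 : 'I_N.+1] i == N.
  rewrite (bigD1 i0) //= big1 ?ffunE ?eqxx ?addn0 // => i ii0.
  by rewrite ffunE (negPf ii0).
pose x0 := GridPoint x0P.
have [||||T [cT dT cTI]] :=
  @scarf I _ _ grid_rank_inj inr _ _ (inl x0) _ c' _ i0.
- move=> i [x|k] /= ki; rewrite eqxx //.
  by case: (eqVneq k i) ki => [->|//]; rewrite eqxx.
- move=> i k [x|l] ik real; first exact: grid_rank_slack_gt.
  by have := real l; rewrite eqxx.
- by [].
- by [].
have [f [f_inj fT f_min]] := minima_of_dominant grid_rank_inj cT dT.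
pose A := [set x | inl x \in T]; pose J := [set i | inr i \notin T].
have [a0 a0T] : exists a, inl a \in T.
  move/dominantP: dT => /(_ (inl x0)) dT.
  have [/existsP[a aT]|/existsPn none] := boolP [exists a, inl a \in T].
    by exists a.
  case: dT => i; have : i \in c' @: T by rewrite cTI inE.
  case/imsetP=> -[x|k] vT /=; first by have := none x; rewrite vT.
  by move=> ->; exists (inr k) => //=; rewrite eqxx.
have J_real i : i \in J -> exists x, f i = inl x.
  rewrite inE; case E: (f i) => [x|k]; first by exists x.
  have kT : inr k \in T by rewrite fT -E imset_f.
  have [-> /negP//|ki _] := eqVneq i k.
  have : grid_rank i (f i) <= grid_rank i (inl a0).
    by move: a0T; rewrite fT => /imsetP[l _ ->].
  by rewrite E leqNgt grid_rank_slack_gt.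
pose low i := if f i is inl x then x i : nat else 0.
have low_le i a : i \in J -> a \in A -> low i <= a i.
  move=> iJ; rewrite inE => aT; have [x fi] := J_real i iJ.
  rewrite /low fi; apply: grid_rank_le; rewrite -fi.
  by move: aT; rewrite fT => /imsetP[l _ ->].
have [j0 j0J] : exists j, j \in J.
  have [k0 _ k0E] : exists2 k, k \in [set: I] & inl a0 = f k.
    by apply/imsetP; rewrite -fT.
  apply/existsP; apply: contraT => /existsPn noJ.
  suff : #|T| < #|T| by rewrite ltnn.
  have sT : inr @: [set: I] \subset T :\ inl a0.
    apply/fintype.subsetP => _ /imsetP[k _ ->]; rewrite !inE /=.
    by have := noJ k; rewrite inE negbK.
  rewrite [X in _ < X](cardsD1 (inl a0)) a0T add1n ltnS cT -cardsT.
  rewrite -(@card_imset _ _ (@inr gridpoint I)); first exact: subset_leq_card.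
  by move=> ? ? [].
have big_low : N < \sum_(i in J) (low i).+1.
  rewrite ltnNge; apply/negP => sN.
  (* The point low + 1 on J, completed to a grid point at the coordinate j0. *)
  pose y i := (i \in J) * (low i).+1 +
    (i == j0) * (N - \sum_(i in J) (low i).+1).
  have ysum : \sum_i y i = N.
    rewrite big_split /=; apply: etrans (subnKC sN); congr (_ + _).
      rewrite [RHS]big_mkcond; apply: eq_bigr => i _.
      by case: (i \in J); rewrite ?mul1n ?mul0n.
    move: (N - _) => D; rewrite (bigD1 j0) //= eqxx mul1n.
    by rewrite big1 ?addn0 // => i /negPf ->; rewrite mul0n.
  have yN i : y i < N.+1.
    by rewrite ltnS -[X in _ <= X]ysum (bigD1 i) //= leq_addr.
  have yP : \sum_i [ffun i => Ordinal (yN i)] i == N.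
    by rewrite -[X in _ == X]ysum; apply/eqP/eq_bigr => i _; rewrite ffunE.
  move/dominantP: dT => /(_ (inl (GridPoint yP))); apply=> i.
  have [iJ|] := boolP (i \in J); last first.
    by rewrite inE negbK => iT; exists (inr i) => //=; rewrite eqxx.
  exists (f i); first by rewrite fT imset_f.
  have [x fi] := J_real i iJ; rewrite ltnNge fi; apply/negP => /grid_rank_le.
  rewrite /= ffunE /= /y iJ mul1n /low fi leqNgt.
  by rewrite ltnS leq_addr.
have J_le : #|J| <= #|I| by apply: max_card.
have split_low : \sum_(i in J) (low i).+1 = \sum_(i in J) low i + #|J|.
  by rewrite -sum1_card -big_split /=; apply: eq_bigr => i _; rewrite addn1.
have split_sum (a : gridpoint) :
    \sum_(i in J) (a i : nat) + \sum_(i | i \notin J) (a i : nat) = N.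
  by apply: etrans (sum_coord a); rewrite [RHS](bigID (mem J)).
have small a i : a \in A -> i \notin J -> a i <= #|I|.
  move=> aA iJ; have := split_sum a; rewrite [X in _ + X](bigD1 i) //=.
  have : \sum_(k in J) low k <= \sum_(k in J) (a k : nat).
    by apply: leq_sum => k kJ; apply: low_le.
  move: big_low; rewrite split_low => lt_N le_low sum_N.
  have arith p q x t k l :
    N < p + k -> p <= q -> q + (x + t) = N -> k <= l -> x <= l by lia.
  exact: arith lt_N le_low sum_N J_le.
exists A, J; split=> //.
- by apply/set0Pn; exists a0; rewrite inE.
- move=> j jJ; have : j \in c' @: T by rewrite cTI inE.
  case/imsetP=> -[x|k] vT /= jE; first by exists x; rewrite ?inE.
  by move: jJ; rewrite inE jE vT.
move=> a b i aA bA; have [iJ|iJ] := boolP (i \in J); last first.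
  by rewrite (leq_trans (small a i aA iJ)) ?leq_addl.
have le_low :
    \sum_(k in J | k != i) low k <= \sum_(k in J | k != i) (a k : nat).
  by apply: leq_sum => k /andP[kJ _]; apply: low_le.
have := big_low; rewrite split_low (bigD1 i) //= => lt_N.
have := split_sum a; rewrite (bigD1 i) //= => sum_N.
have arith p q x y z t k l : N < x + p + k -> p <= q -> (y + q) + t = N ->
  k <= l -> x <= z -> y <= z + l by lia.
exact: arith lt_N le_low sum_N J_le (low_le i b iJ bA).
Qed.
End Grid.

(** * A KKM lemma for colourings of the simplex *)

Local Open Scope classical_set_scope.
Local Open Scope ring_scope.

(** The point p is a cluster point of the sets of grid_cluster, as the mesh
    tends to 0.  The bound on the coordinates outside J takes the place of the
    boundary condition on the colouring in Sperner's lemma. *)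
Lemma kkm_coloring (R : realType) (m : nat) (c : ('I_m.+1 -> R) -> 'I_m.+1) :
  exists p : 'I_m.+1 -> R, \sum_i p i = 1 /\
    forall e, 0 < e -> exists J : {set 'I_m.+1},
      (forall j, j \in J -> exists2 q, forall i, `|q i - p i| <= e & c q = j) /\
      (forall i, i \notin J -> p i <= e).
Proof.
pose n := m.+1.
pose q N (a : gridpoint 'I_n N.+1) (i : 'I_n) : R := (a i)%:R / N.+1%:R.
have grid N : exists aJ : gridpoint 'I_n N.+1 * {set 'I_n},
    [/\ forall j, j \in aJ.2 -> exists2 b,
       forall i, `|q N b i - q N aJ.1 i| <= n%:R / N.+1%:R & c (q N b) = j
     & forall i, i \notin aJ.2 -> q N aJ.1 i <= n%:R / N.+1%:R].
  have [A [J [/set0Pn[a aA] Jc Jlow Aclose]]] :=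
    @grid_cluster 'I_n N.+1 ord0 (fun a => c (q N a)).
  rewrite card_ord in Jlow Aclose.
  have N0 : 0 < N.+1%:R^-1 :> R by rewrite invr_gt0 ltr0n.
  exists (a, J); split=> /= [j /Jc[b bA cb]|i iJ]; last first.
    by rewrite /q ler_pM2r // ler_nat Jlow.
  exists b => // i; rewrite /q -mulrBl normrM [X in _ * X]gtr0_norm //.
  have close x y : x \in A -> y \in A -> (x i)%:R <= (y i)%:R + n%:R :> R.
    by move=> xA yA; rewrite -natrD ler_nat Aclose.
  have := close a b aA bA; have := close b a bA aA.
  by rewrite ler_pM2r // ler_norml; lra.
pose aJ N := sval (cid (grid N)).
have q_sum N a : \sum_i q N a i = 1.
  by rewrite -mulr_suml -natr_sum sum_coord divff //.
pose v N : 'rV[R]_n := \row_i q N (aJ N).1 i.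
have cubeK : compact [set w : 'rV[R]_n | forall i, `[0, 1]%classic (w ord0 i)].
  apply: (@rV_compact R n (fun=> `[0, 1]%classic)) => i.
  exact: segment_compact.
have v_cube N : (forall i, `[0, 1]%classic (v N ord0 i)).
  move=> i; rewrite /v mxE /= in_itv /=.
  have q0 k : 0 <= q N (aJ N).1 k by rewrite divr_ge0.
  by rewrite q0 -(q_sum N (aJ N).1) (bigD1 i) //= lerDl sumr_ge0.
have [p [_ p_cluster]] :
    [set w : 'rV[R]_n | forall i, `[0, 1]%classic (w ord0 i)] `&`
    cluster (v @ \oo) !=set0.
  by apply: cubeK; exists 0%N => // N _; exact: v_cube.
have near_p e : 0 < e -> exists N,
    (forall i, `|v N ord0 i - p ord0 i| <= e) /\ n%:R / N.+1%:R <= e.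
  move=> e0.
  have [M M0] : exists M : nat, n%:R / e < M%:R.
    by exists (Num.bound (n%:R / e)); rewrite archi_boundP // divr_ge0 // ltW.
  have [||_ [[N /= MN <-] pN]] :=
    p_cluster (v @` [set N | (M <= N)%N]) (ball p e).
  - by exists M => // N /= MN; exists N.
  - exact: nbhsx_ballx.
  exists N; split=> [i|].
    by case: pN => _ /(_ ord0 i); rewrite distrC => /ltW.
  rewrite ler_pdivrMr ?ltr0n // mulrC -ler_pdivrMr //.
  by rewrite (le_trans (ltW M0)) // ler_nat (leq_trans MN).
exists (p ord0); split.
  apply/eqP; rewrite -subr_eq0 -normr_eq0; apply/eqP/le_anti/andP; split=> //.
  apply/ler_addgt0Pl => e e0; rewrite addr0.
  have [|N [pN _]] := near_p (e / n%:R); first by rewrite divr_gt0.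
  rewrite -(q_sum N (aJ N).1) -sumrB; apply: le_trans (ler_norm_sum _ _ _) _.
  have -> : e = \sum_(i < n) e / n%:R.
    by rewrite sumr_const card_ord -[RHS]mulr_natr divfK // pnatr_eq0.
  by apply: ler_sum => i _; have := pN i; rewrite mxE distrC.
move=> e e0; have [|N [pN nN]] := near_p (e / 2); first by rewrite divr_gt0.
have [Jc Jlow] := svalP (cid (grid N)); rewrite -/(aJ N) in Jc Jlow.
exists (aJ N).2; split=> [j /Jc[b bq cb]|i /Jlow qi].
  exists (q N b) => // i; rewrite [leRHS]splitr.
  apply: le_trans (ler_distD (q N (aJ N).1 i) _ _) _; apply: lerD.
    exact: le_trans (bq i) nN.
  by have := pN i; rewrite mxE.
have := le_trans qi nN; have := pN i; rewrite mxE ler_norml; lra.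
Qed.

(** * Closeness in a Riesz space with unit *)

Section RieszTheory.
Context {R : realType} {E : rieszType R}.
Implicit Types (u x y z : E) (s t : R).

Lemma riesz_leD x y z w : x <= y -> z <= w -> x + z <= y + w.
Proof.
move=> xy zw; apply: le_trans (riesz_leD2r z _ _ xy) _.
by rewrite ![y + _]addrC; exact: riesz_leD2r.
Qed.

Lemma riesz_lerBlDr x y z : (x - y <= z) = (x <= z + y).
Proof.
apply/idP/idP => [/(riesz_leD2r y)|/(riesz_leD2r (- y))].
  by rewrite subrK.
by rewrite addrK.
Qed.

Lemma riesz_scaler_le u s t : 0 <= u -> s <= t -> s *: u <= t *: u.
Proof.
move=> u0 st; rewrite -[s *: u]addr0 -(subrK (s *: u) (t *: u)) addrC.
apply: riesz_leD => //; rewrite -scalerBl.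
by apply: riesz_scale_ge0 => //; rewrite subr_ge0.
Qed.

Lemma join_leP m (F : 'I_m.+1 -> E) z :
  reflect (forall i, F i <= z) (\big[riesz_join/F ord0]_(i < m.+1) F i <= z).
Proof.
have join_seq (r : seq 'I_m.+1) : (\big[riesz_join/F ord0]_(i <- r) F i <= z) =
    (F ord0 <= z) && all (fun i => F i <= z) r.
  elim: r => [|i r IH]; first by rewrite big_nil andbT.
  by rewrite big_cons riesz_geU IH andbCA.
rewrite join_seq; apply: (iffP andP) => [[_ /allP h] i|h].
  by apply: h; rewrite mem_index_enum.
by split; last by apply/allP.
Qed.

Lemma le_join m (F : 'I_m.+1 -> E) i :
  F i <= \big[riesz_join/F ord0]_(i < m.+1) F i.
Proof. by move: i; apply/join_leP. Qed.

(** Comparison in the order with multiples of u, which is equivalent to Dhu u up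
    to a factor 2 (Dhu_close, close_Dhu) and does not mention infima. *)
Definition hu_close u s x y : Prop := x <= y + s *: u /\ y <= x + s *: u.

Lemma hu_close_sym u s x y : hu_close u s x y -> hu_close u s y x.
Proof. by case. Qed.

Lemma hu_close_trans u s t y x z : hu_close u s x y -> hu_close u t y z ->
  hu_close u (s + t) x z.
Proof.
have half x' y' z' s' t' : x' <= y' + s' *: u -> y' <= z' + t' *: u ->
    x' <= z' + (s' + t') *: u.
  move=> xy yz; apply: (le_trans xy); rewrite [s' + t']addrC scalerDl addrA.
  exact: riesz_leD2r.
move=> [xy yx] [yz zy]; split; first exact: half xy yz.
by rewrite [s + t]addrC; exact: half zy yx.
Qed.

Lemma hu_close_weak u s t x y : 0 <= u -> s <= t ->
  hu_close u s x y -> hu_close u t x y.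
Proof.
move=> u0 st [xy yx]; split.
  by apply: le_trans xy _; apply: riesz_leD => //; exact: riesz_scaler_le.
by apply: le_trans yx _; apply: riesz_leD => //; exact: riesz_scaler_le.
Qed.

Lemma hu_closeDr u s x y z : hu_close u s x y -> hu_close u s (x + z) (y + z).
Proof. by move=> [xy yx]; split; rewrite addrAC; exact: riesz_leD2r. Qed.

Lemma hu_closeZ u x s t a : 0 <= u -> `|s - t| <= a ->
  hu_close u a (x + s *: u) (x + t *: u).
Proof.
move=> u0; rewrite ler_norml => /andP[h1 h2].
split; rewrite -addrA -scalerDl; apply: riesz_leD => //;
  by apply: riesz_scaler_le => //; lra.
Qed.

Lemma hu_close_join u m (F G : 'I_m.+1 -> E) s :
  (forall i, hu_close u s (F i) (G i)) ->
  hu_close u s (\big[riesz_join/F ord0]_(i < m.+1) F i)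
            (\big[riesz_join/G ord0]_(i < m.+1) G i).
Proof.
have half (F' G' : 'I_m.+1 -> E) : (forall i, F' i <= G' i + s *: u) ->
    \big[riesz_join/F' ord0]_(i < m.+1) F' i <=
    \big[riesz_join/G' ord0]_(i < m.+1) G' i + s *: u.
  move=> FG; apply/join_leP => i; apply: le_trans (FG i) _.
  exact/riesz_leD2r/le_join.
by move=> FG; split; apply: half => i; case: (FG i).
Qed.

Lemma riesz_le_unit u x : riesz_unit u -> exists n : nat, x <= n%:R *: u.
Proof.
move=> u_unit; have := lexx (riesz_join x 0); rewrite riesz_geU => /andP[xj j0].
by have [n jn] := u_unit.2 _ j0; exists n; exact: le_trans jn.
Qed.

Lemma Dhu_close u s x y : riesz_unit u -> Dhu u x y < s -> hu_close u s x y.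
Proof.
move=> u_unit d_lt.
have pu_lt z : pu u z < s -> z <= s *: u.
  have [n zn] := riesz_le_unit z u_unit.
  move=> /inf_lt[|t /= zt ts]; first by exists n%:R.
  by apply: le_trans zt _; apply: riesz_scaler_le (ltW ts); case: u_unit.
have max0 t : 0 <= Num.max 0 t by rewrite le_max lexx.
have max1 t : t <= Num.max 0 t by rewrite le_max lexx orbT.
split; rewrite addrC -riesz_lerBlDr; apply: pu_lt; apply: le_lt_trans d_lt.
  by rewrite /Dhu -[leLHS]addr0 lerD.
by rewrite /Dhu -[leLHS]add0r lerD.
Qed.

(** If the set of which pu u z is the infimum were not bounded below, pu u z
    would be the default value 0, which is at most s. *)
Lemma close_Dhu u s x y : 0 <= s -> hu_close u s x y -> Dhu u x y <= s + s.
Proof.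
move=> s0.
have pu_le z : z <= s *: u -> pu u z <= s.
  move=> zs.
  have [[_ lb]|no_inf] := pselect (has_inf [set t : R | z <= t *: u]).
    exact: ge_inf.
  by rewrite /pu inf_out.
move=> [xy yx]; rewrite /Dhu; apply: lerD; rewrite ge_max s0 /= pu_le //.
  by rewrite riesz_lerBlDr addrC.
by rewrite riesz_lerBlDr addrC.
Qed.

(** A max-plus combination of the points x j with j in J only.  To keep the
    index type, the other indices repeat the term j0, which changes no
    supremum. *)
Lemma mpconvex_join u (C : set E) m (x F : 'I_m.+1 -> E) (t : 'I_m.+1 -> R)
    (J : {set 'I_m.+1}) (j0 : 'I_m.+1) :
  mpconvex u C -> (forall j, j \in J -> C (x j)) -> (forall j, t j <= 0) ->
  j0 \in J -> t j0 = 0 ->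
  (forall i, F i = if i \in J then x i + t i *: u else x j0) ->
  C (\big[riesz_join/F ord0]_(i < m.+1) F i).
Proof.
move=> Cc Cx t0 j0J tj0 FE; rewrite Cc.
exists m, (fun i => if i \in J then x i else x j0),
  (fun i => if i \in J then t i else 0).
have {}FE : F = fun i => (if i \in J then x i else x j0) +
    (if i \in J then t i else 0) *: u.
  by apply/funext => i; rewrite FE; case: ifP => // _; rewrite scale0r addr0.
split=> [i||]; last by rewrite FE.
  by case: ifP => [/Cx//|_]; exact: Cx.
apply/le_anti/andP; split.
  by apply/bigmax_leP; split=> [|i _]; case: ifP.
by apply: (bigmax_sup j0) => //; rewrite j0J tj0.
Qed.
End RieszTheory.

(** * Fixed points of upper semicontinuous max-plus convex maps *)

Lemma compact_finite_net (R : realType) (X : pseudoMetricType R) (K : set X)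
    (e : R) : compact K -> 0 < e ->
  exists s : seq X, forall k, K k -> exists2 y, y \in s & ball y e k.
Proof.
move=> /compact_near_coveringP cK e0.
(* Nearness along the filter of all sufficiently large finite sets. *)
pose F : set_system (seq X) :=
  [set A | exists s0 : seq X, forall s : seq X, {subset s0 <= s} -> A s].
have FF : Filter F.
  split=> [|A B [sA hA] [sB hB]|A B AB [sA hA]].
  - by exists [::].
  - exists (sA ++ sB) => s ss.
    split; [apply: hA | apply: hB] => x xs; apply: ss;
      by rewrite mem_cat xs ?orbT.
  - by exists sA => s ss; apply/AB/hA.
have [x _|s0 hs0] := cK _ F (fun s k => exists2 y, y \in s & ball y e k) FF.
  exists (ball x e, [set s : seq X | x \in s]); first split=> /=.
  - exact: nbhsx_ballx.
  - by exists [:: x] => s; apply; rewrite mem_head.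
  - by move=> [k s] /= [xk xs]; exists x.
by exists s0 => k Kk; apply: (hs0 s0).
Qed.

Lemma bigmax_lipschitz (R : realType) m (p q : 'I_m.+1 -> R) e :
  (forall i, `|p i - q i| <= e) ->
  `|\big[Num.max/p ord0]_i p i - \big[Num.max/q ord0]_i q i| <= e.
Proof.
have half (p' q' : 'I_m.+1 -> R) : (forall i, p' i <= q' i + e) ->
    \big[Num.max/p' ord0]_i p' i <= \big[Num.max/q' ord0]_i q' i + e.
  move=> pq; have qmax i : p' i <= \big[Num.max/q' ord0]_i q' i + e.
    by apply: le_trans (pq i) _; rewrite lerD2r; apply: le_bigmax.
  by apply/bigmax_leP.
move=> pq; have pq1 i : p i <= q i + e by have := pq i; rewrite ler_norml; lra.
have qp1 i : q i <= p i + e by have := pq i; rewrite ler_norml; lra.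
by have := half p q pq1; have := half q p qp1; rewrite ler_norml; lra.
Qed.

Section FixedPoint.
Context {R : realType} {E : rieszType R} {u : E}.
Context {E_neq0 : exists x : E, x != 0} {E_arch : riesz_archimedean E}.
Context {u_unit : riesz_unit u}.
Context {C : set (hu_space E_neq0 E_arch u_unit)}.

Lemma ball_close (x y : C) e :
  ball x e y -> hu_close u e (val x : E) (val y : E).
Proof. exact: Dhu_close. Qed.

Lemma close_ball (x y : C) s e : 0 <= s -> s + s < e ->
  hu_close u s (val x : E) (val y : E) -> ball x e y.
Proof. by move=> s0 se /(close_Dhu s0) xy; apply: le_lt_trans se. Qed.

Context (C_neq0 : C !=set0) (C_convex : mpconvex u C).
Context (G : C -> set C) (G_usc : mv_usc G) (G_compact : mv_compact G).
Context (G_neq0 : forall x : C, G x !=set0).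
Context (G_convex : forall x : C, mpconvex u (set_val @` G x)).

Let u_ge0 : 0 <= u. Proof. by case: u_unit. Qed.

(** Upper semicontinuity applied to the union of the open balls around the
    points of G x. *)
Lemma usc_close (x : C) (e : R) : 0 < e ->
  exists2 d, 0 < d & forall x' : C, hu_close u d (val x : E) (val x' : E) ->
    forall z, G x' z -> exists2 g, G x g & hu_close u e (val g : E) (val z : E).
Proof.
move=> e0; pose V : set C := \bigcup_(g in G x) interior (ball g e).
have oV : open V by apply: bigcup_open => g _; exact: open_interior.
have : nbhs x [set x' | G x' `<=` V].
  apply: open_nbhs_nbhs; split; first exact: G_usc.
  by move=> g Gg; exists g => //; apply: nbhsx_ballx.
move=> /nbhs_ballP[d /= d0 dV]; exists (d / 3) => [|x' xx' z Gz].
  by rewrite divr_gt0.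
have /dV/(_ z Gz)[g Gg /interior_subset gz] : ball x d x'.
  by apply: close_ball xx'; [rewrite divr_ge0 // ltW | lra].
by exists g => //; apply: ball_close.
Qed.

(** The KKM lemma applied to the colouring of p by a centre y i close to
    G (psi p). *)
Lemma approximate_fixpoint (e : R) : 0 < e ->
  exists x z : C, G x z /\ hu_close u e (val x : E) (val z : E).
Proof.
move=> e0; have [c0 Cc0] := C_neq0.
have [K cK GK] := G_compact.
have e20 : 0 < e / 2 by rewrite divr_gt0.
have [s net] := compact_finite_net cK e20.
pose m := size s; pose n := m.+1.
pose y (i : 'I_n) : C := nth (SigSub (mem_set Cc0)) s i.
have net_y k : K k -> exists i, hu_close u (e / 2) (val (y i) : E) (val k : E).
  case/net => y0 ys /ball_close yk.
  have ilt : (index y0 s < n)%N by rewrite ltnS index_size.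
  by exists (Ordinal ilt); rewrite /y nth_index.
have [M yM] : exists M : nat,
    forall i j, (val (y i) : E) <= val (y j) + M%:R *: u.
  have /choice[f fP] : forall ij : 'I_n * 'I_n, exists N : nat,
      (val (y ij.1) : E) - val (y ij.2) <= N%:R *: u.
    by move=> ij; apply: riesz_le_unit.
  exists (\max_ij f ij)%N => i j; rewrite addrC -riesz_lerBlDr.
  apply: le_trans (fP (i, j)) _; apply: riesz_scaler_le => //.
  by rewrite ler_nat; apply: (leq_bigmax (F := f) (i, j)).
(* The maximal coordinate of a point of the simplex is at least 1 / n.  With
   this slope, a coordinate of at most 1 / (2 n) has a coefficient of at most
   - M in psi, and its term lies below every y j. *)
pose L : R := 2 * n%:R * M%:R.
pose top (p : 'I_n -> R) := \big[Num.max/p ord0]_i p i.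
pose w (p : 'I_n -> R) i := L * (p i - top p).
have L0 : 0 <= L by rewrite !mulr_ge0.
have p_top p i : p i <= top p by apply: le_bigmax.
have w_le0 p i : w p i <= 0.
  by rewrite mulr_ge0_le0 // subr_le0.
have top_at p : exists i, p i = top p.
  case: (@arg_maxP _ _ _ ord0 xpredT p isT) => i _ pi; exists i.
  apply/le_anti; rewrite p_top /=.
  by apply/bigmax_leP; split=> [|k _]; apply: pi.
pose F p i : E := val (y i) + w p i *: u.
pose psi0 p : E := \big[riesz_join/F p ord0]_i F p i.
have psiC p : psi0 p \in C.
  have [i0 ti0] := top_at p.
  apply/mem_set/(mpconvex_join (x := fun i => val (y i) : E) (t := w p)
    (J := finset.setT) (j0 := i0) C_convex) => //.
  - by move=> j _; apply: set_valP.
  - by rewrite inE.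
  - by rewrite /w ti0 subrr mulr0.
  - by move=> i; rewrite inE.
pose psi p : C := SigSub (psiC p).
have psi_close p q d : (forall i, `|p i - q i| <= d) ->
    hu_close u (L * (d + d)) (val (psi p) : E) (val (psi q) : E).
  move=> pq; apply: hu_close_join => i; apply: hu_closeZ => //.
  rewrite -mulrBr normrM ger0_norm //; apply: ler_wpM2l => //.
  have -> : p i - top p - (q i - top q) = (p i - q i) - (top p - top q) by ring.
  apply: le_trans (ler_normB _ _) _; apply: lerD => //.
  exact: bigmax_lipschitz.
have color p : exists i, exists2 g, G (psi p) g &
    hu_close u (e / 2) (val (y i) : E) (val g : E).
  have [g Gg] := G_neq0 (psi p); have [i yg] := net_y _ (GK _ _ Gg).
  by exists i, g.
have [c cP] := choice color.
have [p [p1 pP]] := kkm_coloring c.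
have [d d0 usc] := usc_close (psi p) e20.
pose eta := Num.min (2 * n%:R)^-1 (d / (2 * (L + 1))).
have eta0 : 0 < eta.
  by rewrite lt_min invr_gt0 mulr_gt0 ?divr_gt0 ?mulr_gt0 ?ltr_wpDl // ltr0n.
have [J [Jc Jlow]] := pP eta eta0.
have eta1 : eta <= (2 * n%:R)^-1 by rewrite ge_min lexx.
have eta2 : L * (eta + eta) <= d.
  have : eta <= d / (2 * (L + 1)) by rewrite ge_min lexx orbT.
  rewrite ler_pdivlMr; first by lra.
  by rewrite mulr_gt0 // ltr_wpDl.
have n0 : 0 < n%:R :> R by rewrite ltr0n.
have top_ge : n%:R^-1 <= top p.
  rewrite -[_^-1]mul1r ler_pdivrMr // -[leLHS]p1.
  rewrite (_ : top p * n%:R = \sum_(i < n) top p); first exact: ler_sum.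
  by rewrite sumr_const card_ord [LHS]mulr_natr.
have inv2 : (2 * n%:R)^-1 = n%:R^-1 / 2 :> R by rewrite invfM mulrC.
have ninv0 : 0 < n%:R^-1 :> R by rewrite invr_gt0.
have [j0 top_j0] := top_at p.
have j0J : j0 \in J.
  by apply: contraT => /Jlow; rewrite top_j0; lra.
have gJ j : exists g : C, j \in J ->
    G (psi p) g /\ hu_close u e (val (y j) : E) (val g : E).
  have [jJ|] := boolP (j \in J); last by exists (y j).
  have [q qp cq] := Jc j jJ; have [g Gg yg] := cP q.
  have [|g' Gg' gg'] := usc (psi q) _ g Gg.
    apply: hu_close_weak eta2 _ => //; apply: psi_close => i.
    by rewrite distrC.
  exists g' => _; split=> //; rewrite [e]splitr -cq.
  by apply: hu_close_trans yg _; apply: hu_close_sym.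
have [g gP] := choice gJ.
pose H (i : 'I_n) : E :=
  if i \in J then val (g i) + w p i *: u else val (g j0).
have [|||||z Gz zE] := mpconvex_join (x := fun i => val (g i) : E) (F := H)
    (t := w p) (J := J) (j0 := j0) (G_convex (psi p)) => //.
- by move=> j /gP[Gj _]; exists (g j).
- by rewrite /w top_j0 subrr mulr0.
exists (psi p), z; split=> //.
(* The indices outside J do not contribute to psi p, so that their terms can be
   replaced by the term j0, as in H. *)
pose F' (i : 'I_n) : E := if i \in J then F p i else val (y j0).
have psiE : (val (psi p) : E) = \big[riesz_join/F' ord0]_i F' i.
  apply/le_anti/andP; split; apply/join_leP => i; last first.
    rewrite /F'; case: ifP => _; first exact: le_join.
    apply: le_trans (le_join (F p) j0).
    by rewrite /F /w top_j0 subrr mulr0 scale0r addr0.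
  have [iJ|iJ] := boolP (i \in J).
    by have := le_join F' i; rewrite /F' iJ.
  apply: le_trans (le_join F' j0); rewrite /F' j0J /F {2}/w top_j0 subrr mulr0.
  rewrite scale0r addr0; apply: le_trans (riesz_leD2r _ _ _ (yM i j0)) _.
  rewrite -addrA -scalerDl -[leRHS]addr0; apply: riesz_leD => //.
  rewrite -(scale0r u); apply: riesz_scaler_le => //.
  have -> : M%:R = L * (n%:R^-1 / 2) :> R.
    by rewrite /L; field; rewrite gt_eqF.
  by rewrite -mulrDr mulr_ge0_le0 //; have := Jlow i iJ; lra.
rewrite psiE; rewrite [X in hu_close _ _ _ X]zE.
apply: hu_close_join => i; rewrite /F' /H; case: ifP => [iJ|_].
  by apply: hu_closeDr; case: (gP i iJ).
by case: (gP j0 j0J).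
Qed.

Context (G_closed : forall x : C, closed (G x)).

Lemma usc_compact_fixpoint : exists x : C, G x x.
Proof.
have /choice[xz xzP] (N : nat) : exists xz : C * C,
    G xz.1 xz.2 /\ hu_close u (N.+1%:R^-1) (val xz.1 : E) (val xz.2 : E).
  have [|x [z xzP]] := @approximate_fixpoint N.+1%:R^-1.
    by rewrite invr_gt0 ltr0n.
  by exists (x, z).
have [K cK GK] := G_compact.
have [z [_ z_cluster]] : K `&` cluster ((fun N => (xz N).2) @ \oo) !=set0.
  by apply: cK; exists 0%N => // N _; apply: GK (xzP N).1.
(* A point of G z near z comes from a late approximate fixed point near z. *)
exists z; apply: G_closed => B /nbhs_ballP[r /= r0 rB].
have e0 : 0 < r / 5 by rewrite divr_gt0.
have [d d0 usc] := usc_close z e0.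
pose a := Num.min (r / 5) (d / 2).
have a0 : 0 < a by rewrite lt_min e0 divr_gt0.
have [ar ad] : a <= r / 5 /\ a <= d / 2 by rewrite /a !ge_min !lexx orbT.
have [M Ma] : exists M : nat, a^-1 < M%:R.
  by exists (Num.bound a^-1); rewrite archi_boundP // invr_ge0 ltW.
have [||_ [[N /= MN <-] /ball_close zN]] :=
  z_cluster ((fun N => (xz N).2) @` [set N | (M <= N)%N]) (ball z a).
- by exists M => // N /= MN; exists N.
- exact: nbhsx_ballx.
have Na : N.+1%:R^-1 <= a.
  rewrite -[leRHS]invrK lef_pV2 ?posrE ?invr_gt0 ?ltr0n //.
  by rewrite (le_trans (ltW Ma)) // ler_nat leqW.
have [Gxz xzN] := xzP N.
have [|g Gg gz] := usc (xz N).1 _ _ Gxz.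
  apply: (hu_close_weak (s := a + N.+1%:R^-1)) => //.
    by rewrite [leRHS]splitr lerD // (le_trans Na).
  exact: hu_close_trans zN (hu_close_sym xzN).
exists g; split=> //; apply: rB.
apply: (@close_ball _ _ (a + r / 5)); [lra | lra |].
exact: hu_close_trans zN (hu_close_sym gz).
Qed.

End FixedPoint.

Theorem theorem7 (R : realType) (E : rieszType R) (u : E)
  (E_neq0 : exists x : E, x != 0) (E_arch : riesz_archimedean E)
  (u_unit : riesz_unit u)
  (C : set (hu_space E_neq0 E_arch u_unit))
  (C_neq0 : C !=set0) (C_convex : mpconvex u C)
  (G : C -> set C)
  (G_usc : mv_usc G) (G_compact : mv_compact G)
  (G_neq0 : forall x : C, G x !=set0)
  (G_closed : forall x : C, closed (G x))
  (G_convex : forall x : C, mpconvex u (set_val @` G x)) :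
  exists x : C, G x x.
Proof. exact: usc_compact_fixpoint. Qed.
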